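(* Let $A$ be a finite alphabet, let $g$ be a probability kernel with $\inf g:=\inf_{a\in A,\,x\in\mathcal{X}^-}g(a|x)>0$ and with either $\Delta(g)>0$ or $\Gamma(g)>0$, and let $\mu$ be a shift-invariant probability measure compatible with $g$. Fix $y\in\mathcal{X}^-$ and, for $k\ge1$, let $\mu^{[k]}$ be a $k$-step Markov approximation of $\mu$, i.e. a shift-invariant probability measure compatible with the kernel $g^{[k]}$ defined by $g^{[k]}(a|x_{-k}^{-1}):=g(a|x_{-k}^{-1}y_{-\infty}^{-k-1})$. Then, for all $k\ge1$, $$\bar d(\mu,\mu^{[k]})\le\frac{|A|}{2\sqrt2\,\mathcal{C}\sqrt{\inf g}}\,\mathrm{var}_k(g),$$ where $\mathcal{C}$ equals $\Delta(g)$ or $\Gamma(g)$ depending on which condition ($\Delta(g)>0$ or $\Gamma(g)>0$) $g$ satisfies.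
   Context: $A^{\mathbb{Z}}$ has the product topology and the $\sigma$-algebra generated by cylinders; shift-invariance is with respect to $(T\omega)_i=\omega_{i+1}$. $\mathcal{X}^-=A^{\{\dots,-2,-1\}}$. A probability kernel is a function $g:A\times\mathcal{X}^-\to[0,1]$ with $\sum_{s\in A}g(s|x)=1$ for all $x\in\mathcal{X}^-$; for a left-infinite sequence ending at another index $n-1$, $g(\cdot|\cdot)$ denotes the same function after re-indexing. In $g(a|x_{-k}^{-1}y_{-\infty}^{-k-1})$ the past has entries $x_i$ for $-k\le i\le-1$ and $y_i$ for $i\le-k-1$. A probability measure $\mu$ on $A^{\mathbb{Z}}$ is compatible with $g$ if for all $n\in\mathbb{Z}$, $a\in A$, and $\mu$-a.e. past $x=(\dots,x_{n-2},x_{n-1})$, the conditional probability under $\mu$ that the $n$-th coordinate equals $a$ given the $\sigma$-algebra generated by the coordinates up to $n-1$ is $g(a|x)$. For $j\ge1$ (with $z,z'\in\mathcal{X}^-$): $\mathrm{Osc}_j(g)=\sup\{\frac12\sum_{a\in A}|g(a|z)-g(a|z')|: z_k=z'_k\ \forall k\ne -j\}$; $\mathrm{Var}_j(g)=\sup\{\frac12\sum_{a\in A}|g(a|z)-g(a|z')|: z_k=z'_k\ \forall k\ge -j\}$; $\mathrm{Var}_0(g)=\sup_{z,z'}\frac12\sum_{a\in A}|g(a|z)-g(a|z')|$; $\mathrm{var}_j(g)=\sup\{|g(a|z)-g(a|z')|: a\in A,\ z_k=z'_k\ \forall k\ge-j\}$. $\Delta(g)=1-\sum_{j\ge1}\mathrm{Osc}_j(g)$,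 $\Gamma(g)=\prod_{j\ge0}(1-\mathrm{Var}_j(g))$. A coupling of two probability measures $\mu,\nu$ on $A^{\mathbb{Z}}$ is a probability measure $\mathbb{P}$ on $A^{\mathbb{Z}}\times A^{\mathbb{Z}}$ with first marginal $\mu$ and second marginal $\nu$. The $\bar d$-distance is defined by $\bar d(\mu,\nu)=\inf_{\mathbb{P}}\mathbb{P}(\{(\eta,\omega)\in A^{\mathbb{Z}}\times A^{\mathbb{Z}}:\eta_0\ne\omega_0\})$, the infimum being over all couplings $\mathbb{P}$ of $\mu$ and $\nu$. *)

(* Defs.v *)
From HB Require Import structures.
From mathcomp Require Import all_boot all_order all_algebra.
From mathcomp Require Import all_classical all_reals all_analysis.

Set Implicit Arguments.
Unset Strict Implicit.
Unset Printing Implicit Defensive.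

Import Order.TTheory GRing.Theory Num.Theory.
Import numFieldNormedType.Exports.

Local Open Scope classical_set_scope.
Local Open Scope ring_scope.

(* Measurable types must be pointed, so the alphabet carries a distinguished
   letter. This only makes it nonempty: no definition below depends on the
   choice of that letter. *)
#[short(type=finPointedType)]
HB.structure Definition FinPointed := {T of Finite T & Pointed T}.

Definition cylinders (A : finPointedType) : set (set (int -> A)) :=
  [set C | exists (s : seq int) (x : int -> A),
    C = [set w : int -> A | {in s, w =1 x}]].

(* The space A^Z with the sigma-algebra generated by cylinders. *)
Definition biseq (A : finPointedType) := g_sigma_algebraType (@cylinders A).

Definition shift (A : finPointedType) (w : biseq A) : biseq A :=
  fun i : int => w (i + 1).

(* A left-infinite sequence (..., x_{-2}, x_{-1}): [x i] is the entry of index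
   -(i+1), so that x_{-1} = x 0. *)
Definition past (A : finPointedType) := nat -> A.

(* The past (..., w_{n-2}, w_{n-1}), re-indexed so as to end at -1. *)
Definition past_at (A : finPointedType) (n : int) (w : biseq A) : past A :=
  fun i : nat => w (n - i.+1%:Z).

Definition is_kernel (R : realType) (A : finPointedType)
    (g : A -> past A -> R) : Prop :=
  (forall a x, 0 <= g a x <= 1) /\ (forall x, \sum_(a : A) g a x = 1).

Definition inf_kernel (R : realType) (A : finPointedType)
    (g : A -> past A -> R) : R :=
  inf [set r | exists (a : A) (x : past A), r = g a x].

Definition half_l1 (R : realType) (A : finPointedType)
    (g : A -> past A -> R) (z z' : past A) : R :=
  2^-1 * \sum_(a : A) `|g a z - g a z'|.

(* Osc_j, for j >= 1. *)
Definition Osc (R : realType) (A : finPointedType)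
    (g : A -> past A -> R) (j : nat) : R :=
  sup [set r | exists z z' : past A,
    (forall i : nat, i.+1 != j -> z i = z' i) /\ r = half_l1 g z z'].

(* Var_j, for j >= 0: when j = 0 no constraint is put on z and z'. *)
Definition Var (R : realType) (A : finPointedType)
    (g : A -> past A -> R) (j : nat) : R :=
  sup [set r | exists z z' : past A,
    (forall i : nat, (i.+1 <= j)%N -> z i = z' i) /\ r = half_l1 g z z'].

Definition var (R : realType) (A : finPointedType)
    (g : A -> past A -> R) (j : nat) : R :=
  sup [set r | exists (a : A) (z z' : past A),
    (forall i : nat, (i.+1 <= j)%N -> z i = z' i) /\ r = `|g a z - g a z'|].

(* Extended-real valued, because the oscillations need not be summable. *)
Definition Delta (R : realType) (A : finPointedType)
    (g : A -> past A -> R) : \bar R :=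
  (1 - \sum_(1 <= j <oo) (Osc g j)%:E)%E.

(* The partial products are nonnegative and nonincreasing, so the limit exists
   for every kernel. *)
Definition Gamma (R : realType) (A : finPointedType)
    (g : A -> past A -> R) : R :=
  lim ((\prod_(0 <= j < n) (1 - Var g j)) @[n --> \oo]).

Definition shift_invariant (R : realType) (A : finPointedType)
    (mu : probability (biseq A) R) : Prop :=
  forall B : set (biseq A), measurable B -> mu (@shift A @^-1` B) = mu B.

(* Generators of the sigma-algebra of the coordinates up to n - 1. *)
Definition past_sets (A : finPointedType) (n : int) : set (set (biseq A)) :=
  [set B | exists (i : int) (a : A), i < n /\ B = [set w : biseq A | w i = a]].

(* [h] is a version of the conditional probability of [E] given the
   sigma-algebra generated by [G]. *)
Definition is_cond_prob (R : realType) (A : finPointedType)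
    (mu : probability (biseq A) R) (G : set (set (biseq A)))
    (E : set (biseq A)) (h : biseq A -> R) : Prop :=
  [/\ measurable_fun [set: g_sigma_algebraType G]
        (h : g_sigma_algebraType G -> R),
      mu.-integrable [set: biseq A] (EFin \o h) &
      forall B : set (biseq A), <<s G >> B ->
        (\int[mu]_(w in B) (h w)%:E = mu (E `&` B))%E].

(* [g] is not assumed to be measurable, so it is compared almost everywhere to
   a version of the conditional probability. *)
Definition compatible (R : realType) (A : finPointedType)
    (mu : probability (biseq A) R) (g : A -> past A -> R) : Prop :=
  forall (n : int) (a : A), exists2 h : biseq A -> R,
    is_cond_prob mu (@past_sets A n) [set w : biseq A | w n = a] h &
    {ae mu, forall w, h w = g a (past_at n w)}.

(* The past x_{-k}^{-1} y_{-oo}^{-k-1}. *)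
Definition splice (A : finPointedType) (k : nat) (x y : past A) : past A :=
  fun i : nat => if (i < k)%N then x i else y i.

Definition markov_kernel (R : realType) (A : finPointedType)
    (g : A -> past A -> R) (y : past A) (k : nat) : A -> past A -> R :=
  fun a x => g a (splice k x y).

Definition is_coupling (R : realType) (A : finPointedType)
    (mu nu : probability (biseq A) R)
    (P : probability (biseq A * biseq A)%type R) : Prop :=
  (forall B : set (biseq A), measurable B -> P (fst @^-1` B) = mu B) /\
  (forall B : set (biseq A), measurable B -> P (snd @^-1` B) = nu B).

Definition dbar (R : realType) (A : finPointedType)
    (mu nu : probability (biseq A) R) : \bar R :=
  ereal_inf [set (P : probability (biseq A * biseq A)%type R)
                   [set w | w.1 0 != w.2 0] | P in is_coupling mu nu].

(* Main.v *)
Require Import Defs.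
From HB Require Import structures.
From mathcomp Require Import all_boot all_order all_algebra.
From mathcomp Require Import all_classical all_reals all_analysis.
From mathcomp Require Import measurable_realfun ring lra.

(* Couplings are not required to be stationary, so the d-bar distance is the
   total variation distance between the laws of the coordinate 0: a maximal
   coupling of these two laws extends to a coupling of the processes.

   Let T be the transfer operator of the Markov kernel g^[k], which acts on
   functions of the last k letters. For such an F, replacing F by T F does not
   change its mean under mu^[k], and changes its mean under mu by at most
   eps = |A| var_k(g) / 2 times the oscillation of F in its newest letter. Start
   from a function of coordinate 0 with oscillation 1 and iterate: it is enough
   that the newest-letter oscillations of the iterates sum to at most 1/C and
   that their global oscillations have bounded sums. If C = Delta(g), this comes
   from the linear recursion d'_j = d_(j+1) + Osc_(j+1)(g) d_0 for the
   oscillations of the iterates; if C = Gamma(g), from the recursion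
   E'_j = (1 - Var_j(g)) E_(j+1) + Var_j(g) E_0, where E_j bounds the variation
   of an iterate between pasts that agree on their last j letters.

   The remaining factor is harmless: inf g <= 1/2 if |A| >= 2, and
   var_k(g) = 0 if |A| = 1. *)

Set Implicit Arguments.
Unset Strict Implicit.
Unset Printing Implicit Defensive.

Import Order.TTheory GRing.Theory Num.Theory.
Import numFieldNormedType.Exports.

Local Open Scope classical_set_scope.
Local Open Scope ring_scope.

(** * Maximal couplings on a finite set *)

(** The common mass [m = min(p, q)] goes on the diagonal and the excesses [p - m], [q - m] are
    coupled independently. No letter carries both excesses, so they add nothing to the diagonal. *)
Lemma max_coupling (R : realFieldType) (A : finType) (p q : A -> R) :
  (forall a, 0 <= p a) -> (forall a, 0 <= q a) ->
  \sum_a p a = 1 -> \sum_a q a = 1 ->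
  exists f : A -> A -> R,
    [/\ forall a b, 0 <= f a b, forall a, \sum_b f a b = p a,
        forall b, \sum_a f a b = q b &
        \sum_a f a a = 1 - 2^-1 * \sum_a `|p a - q a|].
Proof.
move=> p0 q0 p1 q1.
pose m a := Num.min (p a) (q a).
pose t := 1 - \sum_a m a.
have mp a : 0 <= p a - m a by rewrite subr_ge0 ge_min lexx.
have mq a : 0 <= q a - m a by rewrite subr_ge0 ge_min lexx orbT.
have m0 a : 0 <= m a by rewrite le_min p0 q0.
have tp : \sum_a (p a - m a) = t by rewrite sumrB p1.
have tq : \sum_a (q a - m a) = t by rewrite sumrB q1.
have t0 : 0 <= t by rewrite -tp sumr_ge0.
have pt0 a : t = 0 -> p a - m a = 0.
  by move=> te; apply: (psumr_eq0P (P := predT) (F := fun a => p a - m a)) => //;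
    rewrite tp.
have qt0 a : t = 0 -> q a - m a = 0.
  by move=> te; apply: (psumr_eq0P (P := predT) (F := fun a => q a - m a)) => //;
    rewrite tq.
(* [t] is the common mass of the excesses. If [t = 0], the quotient is 0 by convention, as it should
   be, since both excesses vanish. *)
exists (fun a b => (a == b)%:R * m a + (p a - m a) * (q b - m b) / t); split.
- by move=> a b; rewrite addr_ge0 // ?mulr_ge0 // ?invr_ge0.
- move=> a; rewrite big_split /= (bigD1 a) //= eqxx mul1r big1 ?addr0; last first.
    by move=> b ba; rewrite eq_sym (negPf ba) mul0r.
  rewrite -mulr_suml -mulr_sumr tq; have [te|tn] := eqVneq t 0.
    by rewrite te mulr0 mul0r addr0; apply/eqP; rewrite -subr_eq0 -oppr_eq0 opprB pt0.
  by rewrite mulfK // subrKC.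
- move=> b; rewrite big_split /= (bigD1 b) //= eqxx mul1r big1 ?addr0; last first.
    by move=> a ba; rewrite (negPf ba) mul0r.
  rewrite -mulr_suml -mulr_suml tp; have [te|tn] := eqVneq t 0.
    by rewrite te invr0 mulr0 addr0; apply/eqP; rewrite -subr_eq0 -oppr_eq0 opprB qt0.
  by rewrite mulrAC divff // mul1r subrKC.
- rewrite big_split /= [X in _ + X]big1 ?addr0; last first.
    move=> a _; rewrite /m; case: (leP (p a) (q a)) => _; by rewrite subrr ?mulr0 !mul0r.
  have half : 1 = 2^-1 * \sum_a (p a + q a) by rewrite big_split /= p1 q1; lra.
  rewrite [X in _ = X - _]half.
  rewrite -mulrBr -sumrB mulr_sumr; apply: eq_bigr => a _.
  rewrite eqxx mul1r /m; case: (leP (p a) (q a)) => h.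
    by rewrite ler0_norm ?subr_le0 //; lra.
  by rewrite gtr0_norm ?subr_gt0 //; lra.
Qed.

(** Under a maximal coupling the two letters agree with probability at least [1 - v], at cost at
    most [al]; otherwise the cost is at most [be]. *)
Lemma sum_coupling (R : realFieldType) (A : finType) (p q F G : A -> R)
    (al be v : R) :
  (forall a, 0 <= p a) -> (forall a, 0 <= q a) ->
  \sum_a p a = 1 -> \sum_a q a = 1 ->
  (forall a, `|F a - G a| <= al) -> (forall a b, `|F a - G b| <= be) ->
  al <= be -> 2^-1 * \sum_a `|p a - q a| <= v ->
  `|\sum_a p a * F a - \sum_a q a * G a| <= (1 - v) * al + v * be.
Proof.
move=> p0 q0 p1 q1 hal hbe ab hv.
have [f [f0 fp fq fd]] := max_coupling p0 q0 p1 q1.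
have -> : \sum_a p a * F a = \sum_a \sum_b f a b * F a.
  by apply: eq_bigr => a _; rewrite -fp mulr_suml.
have -> : \sum_a q a * G a = \sum_a \sum_b f a b * G b.
  by rewrite exchange_big /=; apply: eq_bigr => a _; rewrite -fq mulr_suml.
rewrite -sumrB.
have f1 : \sum_a \sum_b f a b = 1 by rewrite -p1; apply: eq_bigr => a _.
(* Every pair is charged [be], with a refund [be - al] on the diagonal. *)
apply: (@le_trans _ _ (\sum_a (\sum_b f a b * be - f a a * (be - al)))).
  apply: (le_trans (ler_norm_sum _ _ _)); apply: ler_sum => a _.
  rewrite -sumrB (bigD1 a) //= (bigD1 a (F := fun b => f a b * be)) //= [leRHS]addrAC.
  apply: (le_trans (ler_normD _ _)); apply: lerD.
    by rewrite -!mulrBr normrM ger0_norm // opprB subrKC ler_wpM2l.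
  apply: (le_trans (ler_norm_sum _ _ _)); apply: ler_sum => b _.
  by rewrite -mulrBr normrM ger0_norm // ler_wpM2l.
rewrite sumrB -mulr_suml fd.
under eq_bigr do rewrite -mulr_suml.
by rewrite -mulr_suml f1; nra.
Qed.

Lemma sum_osc (R : realFieldType) (A : finType) (p q F : A -> R) (d : R) :
  (forall a, 0 <= p a) -> (forall a, 0 <= q a) ->
  \sum_a p a = 1 -> \sum_a q a = 1 ->
  (forall a b, `|F a - F b| <= d) ->
  `|\sum_a p a * F a - \sum_a q a * F a| <= 2^-1 * (\sum_a `|p a - q a|) * d.
Proof.
move=> p0 q0 p1 q1 hd; have [a0 _ | A0] := pickP (mem A); last first.
  by rewrite !big1 ?subrr ?normr0 ?mulr0 ?mul0r // => a; have := A0 a.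
have d0 : 0 <= d by apply: le_trans (hd a0 a0).
have := @sum_coupling R A p q F F 0 d _ p0 q0 p1 q1 _ hd d0 (lexx _).
by rewrite mulr0 add0r; apply => a; rewrite subrr normr0.
Qed.

(** The distance becomes a difference of means of one test function, the indicator of [q <= p]; its
    oscillation is at most 1, so the iteration can start from it. *)
Lemma half_l1_pos_part (R : realFieldType) (A : finType) (p q : A -> R) :
  \sum_a p a = 1 -> \sum_a q a = 1 ->
  2^-1 * \sum_a `|p a - q a|
    = \sum_a (q a <= p a)%R%:R * p a - \sum_a (q a <= p a)%R%:R * q a.
Proof.
move=> p1 q1; rewrite -sumrB.
have -> : \sum_a `|p a - q a| = \sum_a `|p a - q a| + \sum_a (p a - q a).
  by rewrite sumrB p1 q1 subrr addr0.
rewrite -big_split /= mulr_sumr; apply: eq_bigr => a _; rewrite -mulrBr.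
case: leP => h; first by rewrite ger0_norm ?subr_ge0 //=; lra.
by rewrite ltr0_norm ?subr_lt0 //=; lra.
Qed.

(** * Means of local functions and the transfer operator *)

Section Words.
Variables (R : realFieldType) (A : finType).
Implicit Types (m : seq A -> R) (u : seq A).

(** Words, like pasts, list the newest letter first: consing adds a newer letter, [rcons] an older
    one. *)
Fixpoint words (k : nat) : seq (seq A) :=
  if k is k'.+1 then [seq a :: u | a <- index_enum A, u <- words k'] else [:: [::]].

Lemma big_wordsS k (f : seq A -> R) :
  \sum_(u <- words k.+1) f u = \sum_a \sum_(u <- words k) f (a :: u).
Proof. by rewrite /= (big_allpairs_dep (h := fun (a : A) u => a :: u)). Qed.

Lemma big_words_rcons k (f : seq A -> R) :
  \sum_(u <- words k.+1) f u = \sum_(u <- words k) \sum_b f (rcons u b).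
Proof.
elim: k f => [|k IH] f.
  rewrite big_wordsS /= big_seq1.
  by apply: eq_bigr => a _; rewrite big_seq1.
rewrite big_wordsS [RHS]big_wordsS; apply: eq_bigr => a _.
by rewrite (IH (fun u => f (a :: u))).
Qed.

Lemma size_words k u : u \in words k -> size u = k.
Proof.
elim: k u => [|k IH] u; first by rewrite inE => /eqP ->.
by case/allpairsP => -[a v] [_ /IH /= h ->] /=; rewrite h.
Qed.

End Words.

Definition pcons (A : Type) (a : A) (x : nat -> A) : nat -> A :=
  fun i => if i is j.+1 then x j else a.

Definition local (R A : Type) (k : nat) (F : (nat -> A) -> R) :=
  forall x x', (forall i, (i < k)%N -> x i = x' i) -> F x = F x'.

Section Transfer.
Variables (R : archiRealFieldType) (A : finType) (a0 : A).
Implicit Types (m : seq A -> R) (u : seq A) (F : (nat -> A) -> R).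

(** Abstract cylinder probabilities; the last condition is consistency when the oldest letter is
    forgotten. *)
Definition is_weight m :=
  [/\ forall u, 0 <= m u, m [::] = 1 & forall u, \sum_b m (rcons u b) = m u].

Definition mean m k F := \sum_(u <- words A k) m u * F (nth a0 u).

Definition transfer (g : A -> (nat -> A) -> R) F : (nat -> A) -> R :=
  fun x => \sum_a g a x * F (pcons a x).

Lemma weight_sum m k : is_weight m -> \sum_(u <- words A k) m u = 1.
Proof.
case=> _ m1 mr; elim: k => [|k IH]; first by rewrite big_seq1.
by rewrite big_words_rcons -[RHS]IH; apply: eq_bigr => u _.
Qed.

Lemma mean_localS m k F : is_weight m -> local k F ->
  mean m k F = mean m k.+1 F.
Proof.
case=> _ _ mr lF; rewrite /mean big_words_rcons !big_seq.
apply: eq_bigr => u /size_words su; rewrite -mr mulr_suml.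
apply: eq_bigr => b _; congr (_ * _); apply: lF => i ik.
by rewrite nth_rcons su ik.
Qed.

(** Both means lie within [r] of one value of [F]. The lost factor 2 is harmless, since [r] will be
    taken small. *)
Lemma mean_osc m m' k F (r : R) : is_weight m -> is_weight m' ->
  (forall x x', `|F x - F x'| <= r) -> `|mean m k F - mean m' k F| <= r *+ 2.
Proof.
move=> wm wm' hr; pose c := F (fun=> a0).
suff H n : is_weight n -> `|mean n k F - c| <= r.
  have -> : mean m k F - mean m' k F = (mean m k F - c) - (mean m' k F - c) by ring.
  by rewrite mulr2n (le_trans (ler_normB _ _)) // lerD // H.
move=> wn; rewrite /mean -[c]mul1r -(weight_sum k wn) mulr_suml -sumrB.
rewrite -[r]mul1r -(weight_sum k wn) mulr_suml.
apply: (le_trans (ler_norm_sum _ _ _)); apply: ler_sum => u _.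
have [n0 _ _] := wn.
by rewrite -mulrBr normrM ger0_norm ?ler_wpM2l ?hr.
Qed.

Lemma pcons_nth a u : nth a0 (a :: u) = pcons a (nth a0 u).
Proof. by apply/funext => -[]. Qed.

(** Dual form of closeness in total variation, up to [e], between [g] and the law under [m] of the
    next letter given the last [k]. The factor [m u] avoids dividing by null weights. *)
Definition transition_upto m k (g : A -> (nat -> A) -> R) (e : R) :=
  forall u (phi : A -> R) (d : R), size u = k ->
    (forall a b, `|phi a - phi b| <= d) ->
    `|\sum_a phi a * (m (a :: u) - g a (nth a0 u) * m u)| <= e * d * m u.

(** View [F] as a function of [k + 1] letters. With the [k] older ones fixed, the difference is the
    transition error tested on [F] as a function of its newest letter. *)
Lemma mean_transfer m k g F (e d : R) : is_weight m -> local k F ->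
  transition_upto m k g e ->
  (forall x a b, `|F (pcons a x) - F (pcons b x)| <= d) ->
  `|mean m k F - mean m k (transfer g F)| <= e * d.
Proof.
move=> wm lF hm hF; rewrite (mean_localS wm lF) /mean big_wordsS exchange_big /=.
rewrite -sumrB -[e * d]mulr1 -(weight_sum k wm) mulr_sumr !big_seq.
apply: (le_trans (ler_norm_sum _ _ _)); apply: ler_sum => u /size_words su.
apply: le_trans (hm u (fun a => F (pcons a (nth a0 u))) d su (hF _)).
rewrite /transfer mulr_sumr -sumrB le_eqVlt; apply/orP; left; apply/eqP.
by congr (Num.norm _); apply: eq_bigr => a _; rewrite pcons_nth; ring.
Qed.

Lemma local_transfer k g F : (forall a, local k (g a)) -> local k F ->
  local k (transfer g F).
Proof.
move=> lg lF x x' h; apply: eq_bigr => a _; rewrite (lg a x x') //.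
by congr (_ * _); apply: lF => -[|i] ik //=; apply: h; apply: ltnW.
Qed.

(** Step [n] of the iteration costs at most [e * u n] under [m] and nothing under [m']. The means of
    the last iterate differ by little for a suitable number of steps, because the sums of [r] are
    bounded. *)
Lemma mean_compare m m' k g F (e c M : R) (u r : nat -> R) :
  is_weight m -> is_weight m' -> (forall a, local k (g a)) -> local k F ->
  0 <= e ->
  transition_upto m k g e -> transition_upto m' k g 0 ->
  (forall n x a b, `|iter n (transfer g) F (pcons a x)
                     - iter n (transfer g) F (pcons b x)| <= u n) ->
  (forall n x x', `|iter n (transfer g) F x - iter n (transfer g) F x'| <= r n) ->
  (forall N, \sum_(n < N) u n <= c) -> (forall N, \sum_(n < N) r n <= M) ->
  `|mean m k F - mean m' k F| <= e * c.
Proof.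
move=> wm wm' lg lF e0 hm hm' hu hr hc hM.
pose T n := iter n (transfer g).
have lT n : local k (T n F).
  by elim: n => // n IH; apply: local_transfer.
have step N : `|mean m k F - mean m' k F| <=
    `|mean m k (T N F) - mean m' k (T N F)| + e * \sum_(n < N) u n.
  elim: N => [|N IH]; first by rewrite big_ord0 mulr0 addr0.
  apply: (le_trans IH); rewrite big_ord_recr /= mulrDr addrA [leRHS]addrAC lerD2r.
  set X := T N F.
  have h1 := mean_transfer wm (lT N) hm (hu N).
  have h2 := mean_transfer wm' (lT N) hm' (hu N).
  rewrite -/X mul0r normr_le0 subr_eq0 in h2; rewrite (eqP h2) -/X.
  rewrite addrC -lerBlDr; apply: le_trans (lerB_dist _ _) _.
  by rewrite opprB addrA subrK.
apply/ler_addgt0Pr => d d0.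
(* Otherwise every [r N] exceeds [d / 2], and more than [|M| / (d / 2)] of them add up to more than
   [M]. *)
have [N hN] : exists N, r N *+ 2 <= d.
  apply: contrapT => /forallNP hN.
  have Md0 : 0 <= `|M| / (d / 2) by rewrite divr_ge0 // divr_ge0 // ltW.
  have := hM (Num.bound (`|M| / (d / 2))); apply/negP; rewrite -ltNge.
  apply: (@le_lt_trans _ _ `|M|); first exact: ler_norm.
  have := archi_boundP Md0; rewrite ltr_pdivrMr ?divr_gt0 // => /lt_le_trans; apply.
  rewrite -[X in X%:R]card_ord -sumr_const mulr_suml ler_sum // => i _.
  by move/negP: (hN i); rewrite -ltNge; lra.
apply: (le_trans (step N)); rewrite addrC lerD //.
  by rewrite ler_wpM2l.
exact: le_trans (mean_osc k wm wm' (hr N)) hN.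
Qed.
End Transfer.

(** * Oscillations of iterates of the transfer operator *)

Section Oscillation.
Variables (R : archiRealFieldType) (A : finType) (g : A -> (nat -> A) -> R).
Hypothesis g0 : forall a x, 0 <= g a x.
Hypothesis g1 : forall x, \sum_a g a x = 1.
Implicit Types (F : (nat -> A) -> R) (x : nat -> A) (phi : A -> R).

(** Indices start at 0: [c j] stands for Osc_(j+1), and [j] for the entry of index -(j+1). *)
Fixpoint osc_seq (c : nat -> R) (n j : nat) : R :=
  if n is n'.+1 then osc_seq c n' j.+1 + c j * osc_seq c n' 0 else (j == 0)%:R.

(** Entry [j] acts in two ways: through [F], where it has moved to place [j + 1], and through the
    law of the new letter, which moves by at most [c j] and is felt only through the oscillation
    [d 0]. *)
Lemma transfer_osc (c : nat -> R) F (d : nat -> R) :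
  (forall j x x', (forall i, i != j -> x i = x' i) ->
     2^-1 * \sum_a `|g a x - g a x'| <= c j) ->
  (forall j x x', (forall i, i != j -> x i = x' i) -> `|F x - F x'| <= d j) ->
  forall j x x', (forall i, i != j -> x i = x' i) ->
    `|transfer g F x - transfer g F x'| <= d j.+1 + c j * d 0.
Proof.
move=> hc hd j x x' h.
have h0 y a b : `|F (pcons a y) - F (pcons b y)| <= d 0.
  by apply: hd => -[|i].
rewrite -(subrKA (\sum_a g a x * F (pcons a x'))) (le_trans (ler_normD _ _)) //.
apply: lerD.
  rewrite -sumrB (le_trans (ler_norm_sum _ _ _)) // -[leRHS]mul1r -(g1 x) mulr_suml.
  apply: ler_sum => a _; rewrite -mulrBr normrM ger0_norm // ler_wpM2l // hd //.
  by case=> // i; rewrite eqSS; apply: h.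
apply: le_trans (sum_osc (F := fun a => F (pcons a x')) _ _ _ _ (h0 x')) _ => //.
rewrite ler_wpM2r // ?hc //.
exact: le_trans (h0 x (x 0) (x 0)).
Qed.

Lemma local_osc k F (d : nat -> R) : local k F ->
  (forall j x x', (forall i, i != j -> x i = x' i) -> `|F x - F x'| <= d j) ->
  forall x x', `|F x - F x'| <= \sum_(j < k) d j.
Proof.
move=> lF hd x x'.
(* Consecutive interpolants differ in a single coordinate. *)
pose y n i := if (i < n)%N then x i else x' i.
have -> : F x = F (y k) by apply: lF => i ik; rewrite /y ik.
have -> : F x' = F (y 0) by [].
elim: k {lF} => [|k IH]; first by rewrite big_ord0 subrr normr0.
rewrite big_ord_recr /= addrC -(subrKA (F (y k))) (le_trans (ler_normD _ _)) //.
rewrite lerD // hd // => i ik; rewrite /y ltnS leq_eqVlt (negPf ik) //.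
Qed.

(** Two Lyapunov functions, both starting at 1. The total [S] drops by at least [C * osc_seq c n 0]
    per step; [W], with weights [j + 1], drops by at least [S n - k * osc_seq c n 0]. Telescoping
    the first gives the first bound, which feeds the second. *)
Lemma osc_seq_bounds (k : nat) (c : nat -> R) (C : R) :
  (0 < k)%N -> 0 < C -> (forall j, 0 <= c j) ->
  (forall j, (k <= j)%N -> c j = 0) -> \sum_(j < k) c j <= 1 - C ->
  (forall N, \sum_(n < N) osc_seq c n 0 <= C^-1) /\
  (forall N, \sum_(n < N) \sum_(j < k) osc_seq c n j <= 1 + k%:R / C).
Proof.
move=> k0 C0 c0 ck hC.
have o0 n j : 0 <= osc_seq c n j.
  by elim: n j => [|n IH] j /=; [rewrite ler0n | rewrite addr_ge0 // mulr_ge0].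
have ok n j : (k <= j)%N -> osc_seq c n j = 0.
  elim: n j => [|n IH] j kj /=; first by rewrite gtn_eqF // (leq_trans k0).
  by rewrite IH ?ck ?mul0r ?addr0 // (leq_trans kj).
(* Entry [k] vanishes, so shifting the index loses only the term at 0. *)
have shift n (w : nat -> R) : \sum_(j < k) w j.+1 * osc_seq c n j.+1 =
    \sum_(j < k) w j * osc_seq c n j - w 0 * osc_seq c n 0.
  apply/eqP; rewrite eq_sym subr_eq addrC; apply/eqP.
  have := big_ord_recl k (fun j : 'I_k.+1 => w j * osc_seq c n j) (op := +%R) (idx := 0).
  by rewrite big_ord_recr /= ok // mulr0 addr0 => ->.
pose S n := \sum_(j < k) osc_seq c n j.
pose W n := \sum_(j < k) j.+1%:R * osc_seq c n j.
have SS n : C * osc_seq c n 0 <= S n - S n.+1.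
  have := shift n (fun=> 1); rewrite /S /=; under eq_bigr do rewrite mul1r.
  under [in RHS]eq_bigr do rewrite mul1r.
  rewrite big_split /= => ->; rewrite -mulr_suml; have := o0 n 0; nra.
have WW n : S n <= W n - W n.+1 + k%:R * osc_seq c n 0.
  have := shift n (fun j => j%:R); rewrite /S /W /= mul0r subr0.
  have -> : \sum_(j < k) j.+1%:R * osc_seq c n j =
      \sum_(j < k) j%:R * osc_seq c n j + \sum_(j < k) osc_seq c n j.
    by rewrite -big_split /=; apply: eq_bigr => j _; rewrite -natr1 mulrDl mul1r.
  move=> e.
  have -> : \sum_(j < k) j.+1%:R * (osc_seq c n j.+1 + c j * osc_seq c n 0) =
      \sum_(j < k) j%:R * osc_seq c n j
      + (\sum_(j < k) j.+1%:R * c j) * osc_seq c n 0.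
    rewrite -e mulr_suml -big_split /=; apply: eq_bigr => j _.
    by rewrite mulrDr mulrA.
  suff : \sum_(j < k) j.+1%:R * c j <= k%:R by have := o0 n 0; nra.
  apply: (@le_trans _ _ (\sum_(j < k) k%:R * c j)).
    by apply: ler_sum => j _; rewrite ler_wpM2r // ler_nat.
  by rewrite -mulr_sumr -[leRHS]mulr1 ler_wpM2l //; lra.
have S0 n : 0 <= S n by rewrite sumr_ge0.
have W0 n : 0 <= W n by rewrite sumr_ge0 // => j _; rewrite mulr_ge0.
have init (w : nat -> R) : \sum_(j < k) w j * osc_seq c 0 j = w 0.
  case: k k0 {ck hC ok shift S W SS WW S0 W0} => // k _.
  by rewrite big_ord_recl /= mulr1 big1 ?addr0 // => j _; rewrite mulr0.
have C1 N : \sum_(n < N) osc_seq c n 0 <= C^-1.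
  have : C * \sum_(n < N) osc_seq c n 0 <= 1 - S N.
    elim: N => [|N IH].
      rewrite big_ord0 mulr0 -(init (fun=> 1)) /S.
      by under eq_bigr do rewrite mul1r; rewrite subrr.
    rewrite big_ord_recr /= mulrDr; have := SS N; lra.
  by move=> h; rewrite -[leRHS]mulr1 ler_pdivlMl //; have := S0 N; lra.
split=> // N; have : \sum_(n < N) S n <= 1 - W N + k%:R * \sum_(n < N) osc_seq c n 0.
  elim: N => [|N IH].
    by rewrite !big_ord0 mulr0 addr0 /W (init (fun j => j.+1%:R)) subrr.
  rewrite !big_ord_recr /= mulrDr; have := WW N; lra.
move=> /le_trans; apply; rewrite lerD //; first by have := W0 N; lra.
by rewrite ler_wpM2l.
Qed.

Lemma iter_transfer_osc (c : nat -> R) phi :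
  (forall j x x', (forall i, i != j -> x i = x' i) ->
     2^-1 * \sum_a `|g a x - g a x'| <= c j) ->
  (forall a b, `|phi a - phi b| <= 1) ->
  forall n j x x', (forall i, i != j -> x i = x' i) ->
   `|iter n (transfer g) (fun x => phi (x 0)) x
     - iter n (transfer g) (fun x => phi (x 0)) x'| <= osc_seq c n j.
Proof.
move=> hc hphi; elim=> [|n IH] /=; last exact: transfer_osc.
by case=> [|j] x x' h //=; rewrite h // subrr normr0.
Qed.

(** For [v] in [0, 1], this is the probability that a house-of-cards chain started at age [j] has
    age 0 at time [n]; from age [i] it is reset to 0 with probability [v i] and otherwise ages by
    one. *)
Fixpoint age_seq (v : nat -> R) (n j : nat) : R :=
  if n is n'.+1 then (1 - v j) * age_seq v n' j.+1 + v j * age_seq v n' 0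
  else (j == 0)%:R.

Lemma age_seq_ge0 (v : nat -> R) n j : (forall j, 0 <= v j <= 1) ->
  0 <= age_seq v n j.
Proof.
move=> v01; elim: n j => [|n IH] j /=; first by rewrite ler0n.
by have /andP[? ?] := v01 j; rewrite addr_ge0 // mulr_ge0 // subr_ge0.
Qed.

(** Induction on [n]: as [v] is nonincreasing, a higher age puts less weight on the reset value,
    which is the largest entry. This supplies [al <= be] in [sum_coupling]. *)
Lemma age_seq_le (v : nat -> R) n j : (forall j, 0 <= v j <= 1) ->
  (forall j, v j.+1 <= v j) -> age_seq v n j <= age_seq v n 0.
Proof.
move=> v01 vd; have step m i : age_seq v m i.+1 <= age_seq v m i; last first.
  by elim: j => // j; apply: le_trans.
suff : age_seq v m i.+1 <= age_seq v m i /\ age_seq v m i <= age_seq v m 0 by case.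
elim: m i => [|m IH] i /=.
  by split; [rewrite ler_nat | case: i].
have dec l : age_seq v m.+1 l.+1 <= age_seq v m.+1 l.
  rewrite /=; have := IH l.+1; have := IH l.+2; have := vd l; have := v01 l.
  by have := v01 l.+1; move=> /andP[? ?] /andP[? ?] ? [? ?] [? ?]; nra.
split; first exact: dec.
by elim: i => // i; apply: le_trans; apply: dec.
Qed.

(** A chain leaving age 0 never returns with probability [P 0], so its mean number of visits to 0 is
    at most [1 / P 0]. Below, [S N j] is the mean number of visits before time [N] from age [j]. *)
Lemma age_seq_sum (v : nat -> R) (k : nat) : (forall j, 0 <= v j <= 1) ->
  (forall j, (k <= j)%N -> v j = 0) -> 0 < \prod_(0 <= j < k) (1 - v j) ->
  forall N, \sum_(n < N) age_seq v n 0 <= (\prod_(0 <= j < k) (1 - v j))^-1.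
Proof.
move=> v01 vk P0.
pose P j := \prod_(j <= i < k) (1 - v i).
have PS j : P j = (1 - v j) * P j.+1.
  have [jk|kj] := ltnP j k; first by rewrite /P big_ltn.
  by rewrite /P !big_geq ?vk ?subr0 ?mulr1 // leqW.
have Pge0 j : 0 <= P j.
  by apply: prodr_ge0 => i _; have /andP[? ?] := v01 i; rewrite subr_ge0.
pose S N j := \sum_(n < N) age_seq v n j.
have S0 N j : 0 <= S N j by rewrite sumr_ge0 // => n _; apply: age_seq_ge0.
have Srec N j : S N.+1 j = (j == 0)%:R + (1 - v j) * S N j.+1 + v j * S N 0.
  by rewrite /S big_ord_recl /= big_split /= -!mulr_sumr addrA.
have Sle N j : S N j <= S N.+1 j.
  by rewrite /S big_ord_recr /= lerDl age_seq_ge0.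
(* From age [j + 1] a reset occurs with probability [1 - P j.+1], and the count restarts from age
   0. *)
have HS N j : S N j.+1 <= S N 0 * (1 - P j.+1).
  elim: N j => [|N IH] j; first by rewrite /S !big_ord0 mul0r.
  have P1 i : P i <= 1.
    by apply: prodr_ile1 => l _; have /andP[? ?] := v01 l; rewrite subr_ge0 gerBl;
      apply/andP.
  apply: (@le_trans _ _ (S N 0 * (1 - P j.+1))); last first.
    by rewrite ler_wpM2r // subr_ge0.
  rewrite Srec /= add0r PS; have := IH j.+1; have := v01 j.+1 => /andP[? ?].
  by have := S0 N 0; nra.
elim=> [|N IH]; first by rewrite big_ord0 invr_ge0 ltW.
rewrite -/(P 0) in P0 IH *; rewrite -/(S N.+1 0) Srec /=.
rewrite -/(S N 0) in IH.
have h := HS N 0; have e := PS 0; have /andP[? ?] := v01 0.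
apply: (@le_trans _ _ (1 + S N 0 * (1 - P 0))); first by rewrite e; nra.
have P01 : P 0 <= 1.
  by apply: prodr_ile1 => l _; have /andP[? ?] := v01 l; rewrite subr_ge0 gerBl;
      apply/andP.
(* [(P 0)^-1] is the fixed point of the map sending [s] to [1 + s * (1 - P 0)]. *)
apply: (@le_trans _ _ (1 + (P 0)^-1 * (1 - P 0))).
  by rewrite lerD2l ler_wpM2r // subr_ge0.
by rewrite mulrBr mulr1 mulVf ?gt_eqF // addrC subrK.
Qed.

(** Couple the next letters of two pasts agreeing on [j] letters: if they are equal the agreement
    grows to [j + 1], otherwise nothing is assumed to agree. *)
Lemma iter_transfer_age (v : nat -> R) phi :
  (forall j, 0 <= v j <= 1) -> (forall j, v j.+1 <= v j) ->
  (forall j x x', (forall i, (i < j)%N -> x i = x' i) ->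
     2^-1 * \sum_a `|g a x - g a x'| <= v j) ->
  (forall a b, `|phi a - phi b| <= 1) ->
  forall n j x x', (forall i, (i < j)%N -> x i = x' i) ->
   `|iter n (transfer g) (fun x => phi (x 0)) x
     - iter n (transfer g) (fun x => phi (x 0)) x'| <= age_seq v n j.
Proof.
move=> v01 vd hv hphi; elim=> [|n IH] j x x' h /=.
  by case: j h => [|j] h //=; rewrite h // subrr normr0.
apply: sum_coupling => //.
- by move=> a; apply: IH => -[|i] //= ij; apply: h.
- by move=> a b; apply: IH.
- exact: age_seq_le.
- exact: hv.
Qed.

End Oscillation.

(** * Bounds from the kernel coefficients *)

Section Kernel.
Variables (R : realType) (A : finPointedType) (g : A -> past A -> R).
Hypothesis gK : is_kernel g.
Implicit Types (z x : past A).

Lemma half_l1_ge0 z z' : 0 <= half_l1 g z z'.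
Proof. by rewrite mulr_ge0 ?invr_ge0 // sumr_ge0. Qed.

Lemma half_l1_le1 z z' : half_l1 g z z' <= 1.
Proof.
have [g01 g1] := gK.
have -> : (1 : R) = 2^-1 * \sum_a (g a z + g a z').
  by rewrite big_split /= !g1 mulVf.
rewrite ler_wpM2l ?invr_ge0 // ler_sum // => a _.
have /andP[? _] := g01 a z; have /andP[? _] := g01 a z'.
by rewrite (le_trans (ler_normB _ _)) // !ger0_norm.
Qed.

Lemma half_l1_eq z : half_l1 g z z = 0.
Proof. by rewrite /half_l1 big1 ?mulr0 // => a _; rewrite subrr normr0. Qed.

Lemma half_l1_Osc j z z' : (forall i, i.+1 != j -> z i = z' i) ->
  half_l1 g z z' <= Osc g j.
Proof.
move=> h; apply: ub_le_sup; last by exists z, z'.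
by exists 1 => _ [? [? [_ ->]]]; apply: half_l1_le1.
Qed.

Lemma half_l1_Var j z z' : (forall i, (i.+1 <= j)%N -> z i = z' i) ->
  half_l1 g z z' <= Var g j.
Proof.
move=> h; apply: ub_le_sup; last by exists z, z'.
by exists 1 => _ [? [? [_ ->]]]; apply: half_l1_le1.
Qed.

Lemma Osc_ge0 j : 0 <= Osc g j.
Proof. by rewrite -(half_l1_eq (fun=> point)) half_l1_Osc. Qed.

Lemma Var01 j : 0 <= Var g j <= 1.
Proof.
rewrite -{1}(half_l1_eq (fun=> point)) half_l1_Var //=.
apply: ge_sup => [|_ [z [z' [_ ->]]]]; last exact: half_l1_le1.
by exists (half_l1 g (fun=> point) (fun=> point)), (fun=> point), (fun=> point).
Qed.

Lemma Var_nincr j : Var g j.+1 <= Var g j.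
Proof.
apply: ge_sup => [|_ [z [z' [h ->]]]].
  by exists (half_l1 g (fun=> point) (fun=> point)), (fun=> point), (fun=> point).
by apply: half_l1_Var => i ij; apply: h; apply: leqW.
Qed.

Lemma ler_var j a z z' : (forall i, (i.+1 <= j)%N -> z i = z' i) ->
  `|g a z - g a z'| <= var g j.
Proof.
move=> h; apply: ub_le_sup; last by exists a, z, z'.
exists 1 => _ [b [x [x' [_ ->]]]]; have [g01 _] := gK.
by have := g01 b x; have := g01 b x'; rewrite ler_norml => /andP[? ?] /andP[? ?]; lra.
Qed.

Lemma var_ge0 j : 0 <= var g j.
Proof. by apply: le_trans (@ler_var j point point point _). Qed.

Lemma inf_kernel_le a x : inf_kernel g <= g a x.
Proof.
apply: ge_inf; last by exists a, x.
by exists 0 => _ [b [z ->]]; have [g01 _] := gK; have /andP[] := g01 b z.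
Qed.

Lemma markov_kernelP y k : is_kernel (markov_kernel g y k).
Proof. by have [g01 g1] := gK; split=> *; [apply: g01 | apply: g1]. Qed.

Lemma markov_kernel_local y k a : local k (markov_kernel g y k a).
Proof.
move=> x x' h; rewrite /markov_kernel; congr (g a _); apply/funext => i.
by rewrite /splice; case: ifP => // /h.
Qed.

Lemma Delta_sum k C : C%:E = Delta g -> \sum_(j < k) Osc g j.+1 <= 1 - C.
Proof.
rewrite /Delta => hC.
have := @nneseries_lim_ge R (fun j => (Osc g j)%:E) predT 1 k.+1.
have := hC; set s := limn _; case: s => [s||] //= [->] h.
have {h} := h (fun j _ _ => _); rewrite sumEFin lee_fin => h.
rewrite opprB addrCA subrr addr0; apply: le_trans (h _); last first.
  by move=> j; rewrite lee_fin Osc_ge0.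
by rewrite big_add1 /= big_mkord.
Qed.

Lemma Gamma_le k : Gamma g <= \prod_(0 <= j < k) (1 - Var g j).
Proof.
have V01 j : 0 <= 1 - Var g j <= 1.
  by have /andP[? ?] := Var01 j; rewrite subr_ge0 gerBl;
      apply/andP.
have P0 n : 0 <= \prod_(0 <= j < n) (1 - Var g j).
  by apply: prodr_ge0 => j _; have /andP[] := V01 j.
have P_nincr : nonincreasing_seq (fun n => \prod_(0 <= j < n) (1 - Var g j)).
  apply/nonincreasing_seqP => n; rewrite big_nat_recr //= -[leRHS]mulr1.
  by rewrite ler_wpM2l //; have /andP[] := V01 n.
apply: (nonincreasing_cvgn_ge P_nincr).
apply: nonincreasing_is_cvgn => //.
by exists 0 => _ [n _ <-].
Qed.

(** Splicing two pasts with the same [y] creates no disagreement, so the coefficients of the Markov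
    kernel are bounded by those of [g], and they vanish beyond its memory [k]. *)
Lemma markov_iter_bounds y k (C : R) (phi : A -> R) : (0 < k)%N ->
  ((0 < Delta g)%E /\ C%:E = Delta g) \/ (0 < Gamma g /\ C = Gamma g) ->
  (forall a b, `|phi a - phi b| <= 1) ->
  exists (u r : nat -> R) (M : R),
  let F n := iter n (transfer (markov_kernel g y k)) (fun x => phi (x 0%N)) in
  [/\ forall n x a b, `|F n (pcons a x) - F n (pcons b x)| <= u n,
      forall n x x', `|F n x - F n x'| <= r n,
      forall N, \sum_(n < N) u n <= C^-1 &
      forall N, \sum_(n < N) r n <= M].
Proof.
move=> k0 hC hphi; have [h01 h1] := markov_kernelP y k.
have {}h01 a x : 0 <= markov_kernel g y k a x by have /andP[] := h01 a x.
case: hC => -[C0 CE].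
  pose c j := if (j < k)%N then Osc g j.+1 else 0.
  have ck j : (k <= j)%N -> c j = 0 by rewrite /c ltnNge => ->.
  have c0 j : 0 <= c j by rewrite /c; case: ifP => // _; apply: Osc_ge0.
  have cC : \sum_(j < k) c j <= 1 - C.
    rewrite (le_trans _ (Delta_sum k CE)) // ler_sum // => j _.
    by rewrite /c ltn_ord.
  have C0' : 0 < C by rewrite -lte_fin CE.
  have [s1 s2] := osc_seq_bounds k0 C0' c0 ck cC.
  exists (fun n => osc_seq c n 0), (fun n => \sum_(j < k) osc_seq c n j), (1 + k%:R / C).
  have hcs j x x' : (forall i, i != j -> x i = x' i) ->
      2^-1 * \sum_a `|markov_kernel g y k a x - markov_kernel g y k a x'| <= c j.
    move=> h; rewrite /c; case: ltnP => [jk|kj].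
      apply: half_l1_Osc => i; rewrite eqSS /splice => ij.
      by case: ifP => // _; apply: h.
    rewrite big1 ?mulr0 // => a _; rewrite (@markov_kernel_local y k a x x')
      ?subrr ?normr0 //.
    by move=> i ik; apply: h; rewrite ltn_eqF // (leq_trans ik).
  have HO := iter_transfer_osc h01 h1 hcs hphi.
  split=> //.
    by move=> n x a b; apply: HO => -[].
  move=> n x x'; apply: local_osc; last exact: HO.
  elim: n => [|n IH] /=; first by move=> z z' hz; rewrite hz.
  by apply: local_transfer => // a; apply: markov_kernel_local.
pose v j := if (j < k)%N then Var g j else 0.
have v01 j : 0 <= v j <= 1.
  by rewrite /v; case: ifP => _; [apply: Var01 | rewrite lexx ler01].
have vd j : v j.+1 <= v j.
  rewrite /v; case: (ltnP j.+1 k) => jk; first by rewrite ltnW // Var_nincr.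
  by case: ifP => // _; have /andP[] := Var01 j.
have vk j : (k <= j)%N -> v j = 0 by rewrite /v ltnNge => ->.
have PE : \prod_(0 <= j < k) (1 - v j) = \prod_(0 <= j < k) (1 - Var g j).
  by apply: eq_big_nat => j /andP[_ jk]; rewrite /v jk.
have Pge : C <= \prod_(0 <= j < k) (1 - v j) by rewrite PE CE Gamma_le.
have C0' : 0 < C by rewrite CE.
have P0 : 0 < \prod_(0 <= j < k) (1 - v j) by apply: lt_le_trans Pge.
have s N : \sum_(n < N) age_seq v n 0 <= C^-1.
  rewrite (le_trans (age_seq_sum v01 vk P0 N)) // lef_pV2 //.
have hv j x x' : (forall i, (i < j)%N -> x i = x' i) ->
    2^-1 * \sum_a `|markov_kernel g y k a x - markov_kernel g y k a x'| <= v j.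
  move=> h; rewrite /v; case: ltnP => [jk|kj].
    apply: half_l1_Var => i ij; rewrite /splice.
    by case: ifP => // _; apply: h.
  rewrite big1 ?mulr0 // => a _; rewrite (@markov_kernel_local y k a x x')
      ?subrr ?normr0 //.
  by move=> i ik; apply: h; apply: leq_trans kj.
have HO := iter_transfer_age h01 h1 v01 vd hv hphi.
(* Taking [j = 0] allows arbitrary pasts, so one sequence bounds both oscillations. *)
exists (fun n => age_seq v n 0), (fun n => age_seq v n 0), C^-1.
by split=> // *; apply: HO.
Qed.

End Kernel.

(** * Cylinder weights of a compatible measure *)

(** The left side is the modulus of the integral over [B] of the sum bounded by [c]. It will serve
    with [h] conditional probabilities and [q] kernel values. *)
Lemma le_integral_comb (R : realType) d (T : measurableType d)
    (mu : probability T R) (B : set T) (I : finType) (phi q : I -> R)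
    (h : I -> T -> R) (c : R) :
  measurable B -> 0 <= c -> (forall i, mu.-integrable B (EFin \o h i)) ->
  {ae mu, forall x, B x -> `|\sum_i phi i * (h i x - q i)| <= c} ->
  `|\sum_i phi i * (fine (\int[mu]_(x in B) (h i x)%:E) - q i * fine (mu B))|
    <= c * fine (mu B).
Proof.
move=> mB c0 hB hae.
have muB : mu B \is a fin_num by apply: fin_num_measure.
have cB r : mu.-integrable B (EFin \o cst r).
  by apply: finite_measure_integrable_cst.
have hc i : mu.-integrable B (EFin \o (fun x => h i x - q i)).
  exact: (integrableB mB (hB i) (cB (q i))).
pose H x := \sum_i phi i * (h i x - q i).
have HE : EFin \o H = (fun x => \sum_i ((phi i)%:E * (h i x - q i)%:E)%E).
  by apply/funext => x; rewrite /= -sumEFin; apply: eq_bigr.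
have hZ i : mu.-integrable B (fun x => (phi i)%:E * (h i x - q i)%:E)%E.
  exact: (integrableZl mB (phi i) (hc i)).
have hH : mu.-integrable B (EFin \o H).
  by rewrite HE; apply: integrable_sum.
have -> : \sum_i phi i * (fine (\int[mu]_(x in B) (h i x)%:E) - q i * fine (mu B)) =
    fine (\int[mu]_(x in B) (H x)%:E).
  apply: EFin_inj; rewrite fineK; last exact: integrable_fin_num.
  rewrite -[X in integral _ _ X]/(EFin \o H) HE integral_sum // -sumEFin.
  apply: eq_bigr => i _; rewrite integralZl //; last exact: hc.
  rewrite EFinM (integralB_EFin (f2 := cst (q i))) //; congr (_ * _)%E.
  rewrite [X in (_ - X)%E](_ : _ = (q i)%:E * mu B)%E; last first.
    exact: (integral_cst mu mB (q i)%:E).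
  by rewrite EFinB EFinM !fineK //; apply: (integrable_fin_num mB (hB i)).
have [mH _] := integrableP _ _ _ hH.
rewrite -lee_fin EFinM [in leRHS]fineK //.
apply: (@le_trans _ _ (\int[mu]_(x in B) `|(H x)%:E|)%E).
  apply: le_trans (le_abse_integral mu mB mH).
  by rewrite -abse_EFin fineK //; apply: integrable_fin_num.
rewrite -integral_cst //; apply: ae_ge0_le_integral => //.
  exact: measurableT_comp.
Qed.

Section Measure.
Variables (R : realType) (A : finPointedType).
Implicit Types (mu : probability (biseq A) R) (u : seq A).

(** The newest letter of [u] sits at time [n - 1]. *)
Definition cyl (n : int) u : set (biseq A) :=
  [set w | forall i, (i < size u)%N -> past_at n w i = nth point u i].

Definition coord (n : int) (a : A) : set (biseq A) := [set w | w n = a].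

Lemma cyl_cons n a u : cyl (n + 1) (a :: u) = coord n a `&` cyl n u.
Proof.
apply/seteqP; split=> w.
  move=> h; split; first by have := h 0%N isT; rewrite /past_at /= addrK.
  move=> i iu; have := h i.+1 iu; rewrite /past_at /= => <-; congr (w _).
  by rewrite (intS i.+1); ring.
move=> [h0 h] [|i] iu; first by rewrite /past_at /= addrK.
rewrite /= -h // /past_at; congr (w _).
by rewrite (intS i.+1); ring.
Qed.

Lemma cyl_rcons n u b :
  cyl n (rcons u b) = cyl n u `&` coord (n - (size u).+1%:Z) b.
Proof.
apply/seteqP; split=> w.
  move=> h; split; last first.
    by have := h (size u); rewrite size_rcons nth_rcons ltnn eqxx; apply.
  by move=> i iu; have := h i; rewrite size_rcons nth_rcons iu; apply; apply: ltnW.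
move=> [h hb] i; rewrite size_rcons nth_rcons ltnS leq_eqVlt => /orP[/eqP ->|iu].
  by rewrite ltnn eqxx.
by rewrite iu; apply: h.
Qed.

Lemma measurable_coord n a : measurable (coord n a).
Proof.
apply: sub_sigma_algebra; exists [:: n], (fun=> a).
apply/seteqP; split => w.
  by move=> h i; rewrite inE => /eqP ->.
by move=> h; apply: h; rewrite inE.
Qed.

Lemma cyl0 n : cyl n [::] = setT.
Proof. by apply/seteqP; split. Qed.

Lemma past_measurable_cyl n u : <<s @past_sets A n >> (cyl n u).
Proof.
elim/last_ind: u => [|u b IH].
  by rewrite cyl0; apply: (@measurableT _ (g_sigma_algebraType (@past_sets A n))).
rewrite cyl_rcons.
apply: (@measurableI _ (g_sigma_algebraType (@past_sets A n))) => //.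
apply: sub_sigma_algebra; exists (n - (size u).+1%:Z), b; split=> //.
by rewrite ltrBlDr ltrDl.
Qed.

Lemma measurable_cyl n u : measurable (cyl n u).
Proof.
elim/last_ind: u => [|u b IH]; first by rewrite cyl0.
by rewrite cyl_rcons; apply: measurableI => //; apply: measurable_coord.
Qed.

Lemma measure_coord_split mu n (B : set (biseq A)) : measurable B ->
  mu B = (\sum_(a : A) mu (B `&` coord n a))%E.
Proof.
move=> mB; rewrite fsbig_seq ?index_enum_uniq // -measure_fin_bigcup //=.
- congr (mu _); rewrite -setI_bigcupr -[LHS]setIT; congr (_ `&` _).
  by apply/esym; rewrite -subTset => w _; exists (w n); rewrite //= mem_index_enum.
- by move=> a b _ _ [w [[_ <-] [_ <-]]].
- by move=> a _; apply: measurableI => //; apply: measurable_coord.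
Qed.

Definition weight mu u : R := fine (mu (cyl 0 u)).

Lemma weightE mu u : (weight mu u)%:E = mu (cyl 0 u).
Proof. by rewrite fineK // fin_num_measure //; apply: measurable_cyl. Qed.

Lemma weightP mu : is_weight (weight mu).
Proof.
split=> [u||u]; first exact: fine_ge0.
  by rewrite /weight cyl0 probability_setT.
apply: EFin_inj; rewrite -sumEFin weightE.
rewrite (@measure_coord_split mu (0 - (size u).+1%:Z)); last exact: measurable_cyl.
by apply: eq_bigr => b _; rewrite weightE cyl_rcons.
Qed.

(** Stationarity moves the newest letter from time -1 to time 0, where compatibility describes its
    law given the past. *)
Lemma weight_cons mu a u : shift_invariant mu ->
  (weight mu (a :: u))%:E = mu (coord 0 a `&` cyl 0 u).
Proof.
move=> inv; rewrite weightE -cyl_cons -(inv (cyl 0 (a :: u))); last exact: measurable_cyl.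
congr (mu _); apply/seteqP; split => w h i iu; have := h i iu;
  rewrite /past_at /shift => <-; congr (w _); ring.
Qed.

(** On the cylinder of [u], the law of coordinate 0 given the past is almost surely [g], within [e]
    of [g'], which depends on [u] alone there. It remains to integrate. *)
Lemma weight_transition mu (g g' : A -> past A -> R) k e :
  shift_invariant mu -> compatible mu g -> is_kernel g ->
  is_kernel g' -> (forall a, local k (g' a)) ->
  (forall x, 2^-1 * \sum_a `|g a x - g' a x| <= e) ->
  transition_upto point (weight mu) k g' e.
Proof.
move=> inv comp [g01 g1] [g'01 g'1] lg' he u phi d su hphi.
have d0 : 0 <= d by apply: le_trans (hphi point point).
have [h hcp hae] : exists2 h : A -> biseq A -> R,
    forall a, is_cond_prob mu (@past_sets A 0) (coord 0 a) (h a) &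
    forall a, {ae mu, forall w, h a w = g a (past_at 0 w)}.
  have [h hP] := choice (fun a => let: ex_intro2 h h1 h2 := comp 0 a in
    ex_intro (fun h => is_cond_prob mu (@past_sets A 0) (coord 0 a) h /\
      {ae mu, forall w, h w = g a (past_at 0 w)}) h (conj h1 h2)).
  by exists h => a; have [] := hP a.
pose B := cyl 0 u; have mB : measurable B by apply: measurable_cyl.
pose q a := g' a (nth point u).
have hB a : mu.-integrable B (EFin \o h a).
  have [_ hi _] := hcp a; exact: integrableS hi.
(* The alphabet being finite, one null set serves all letters. *)
have hall : {ae mu, forall w, forall a, h a w = g a (past_at 0 w)}.
  exact: filter_forall.
have e0 : 0 <= e.
  by apply: le_trans (he point); rewrite mulr_ge0 ?invr_ge0 // sumr_ge0.
have -> : \sum_a phi a * (weight mu (a :: u) - q a * weight mu u) =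
    \sum_a phi a * (fine (\int[mu]_(w in B) (h a w)%:E) - q a * fine (mu B)).
  apply: eq_bigr => a _; congr (_ * (_ - _)); apply: EFin_inj.
  have [_ _ ->] := hcp a; last exact: past_measurable_cyl.
  by rewrite weight_cons // fineK // fin_num_measure //; apply: measurableI => //;
    apply: measurable_coord.
apply: le_integral_comb => //; first by rewrite mulr_ge0.
apply: filterS hall => w hw Bw.
have -> : \sum_a phi a * (h a w - q a) =
    \sum_a g a (past_at 0 w) * phi a - \sum_a g' a (past_at 0 w) * phi a.
  rewrite -sumrB; apply: eq_bigr => a _; rewrite hw /q.
  rewrite (lg' a (nth point u) (past_at 0 w)); first by ring.
  by move=> i ik; rewrite Bw // su.
have [gx0 g'x0] : (forall a, 0 <= g a (past_at 0 w)) /\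
    (forall a, 0 <= g' a (past_at 0 w)).
  by split=> a; [have /andP[] := g01 a (past_at 0 w) |
    have /andP[] := g'01 a (past_at 0 w)].
apply: le_trans (sum_osc gx0 g'x0 (g1 _) (g'1 _) hphi) _.
by rewrite ler_wpM2r.
Qed.

End Measure.

(** * The d-bar distance and the laws of the coordinate 0 *)

Section Coupling.
Variables (R : realType) (A : finPointedType).
Variables (mu nu : probability (biseq A) R) (c : A * A -> {nonneg R}).

Definition rect (ab : A * A) : set (biseq A * biseq A) :=
  coord 0 ab.1 `*` coord 0 ab.2.

Lemma measurable_rect ab : measurable (rect ab).
Proof. by apply: measurableX; apply: measurable_coord. Qed.

(* Reweights [mu \x nu] by the constant [c (a, b)] on each event
   [w.1 0 = a, w.2 0 = b]. *)
Definition reweighted : set (biseq A * biseq A) -> \bar R :=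
  msum (fun n => mscale (c (nth point (enum {: A * A}) n))
    (mrestr (mu \x nu)%E (measurable_rect (nth point (enum {: A * A}) n))))
  #|{: A * A}|.

HB.instance Definition _ := Measure.on reweighted.

Lemma reweightedE B : reweighted B =
  (\sum_(a : A) \sum_(b : A) (c (a, b))%:num%:E * (mu \x nu) (B `&` rect (a, b)))%E.
Proof.
rewrite /reweighted /msum /mscale /mrestr /= cardE pair_big /=.
rewrite -(big_mkord xpredT (fun n => ((c (nth point (enum {: A * A}) n))%:num%:E *
  (mu \x nu) (B `&` rect (nth point (enum {: A * A}) n)))%E)).
rewrite -(big_nth point xpredT (fun ab => ((c ab)%:num%:E * (mu \x nu) (B `&` rect ab))%E)).
by rewrite big_enum /=; apply: eq_bigr => -[a b].
Qed.

End Coupling.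

(** This yields the marginals of [reweighted]. Null denominators are harmless: [q i = 0] forces
    [f i = 0], and [p = 0] forces [m = 0]. *)
Lemma rescaled_sum (R : realFieldType) (I : finType) (f q : I -> R) (p m : R) :
  (forall i, 0 <= f i <= q i) -> \sum_i f i = p -> 0 <= m <= p ->
  \sum_i f i / (p * q i) * (m * q i) = m.
Proof.
move=> fq fp /andP[m0 mp].
have -> : \sum_i f i / (p * q i) * (m * q i) = \sum_i f i / p * m.
  apply: eq_bigr => i _; have [q0|q0] := eqVneq (q i) 0.
    have /andP[f0 fi] := fq i; have -> : f i = 0 by lra.
    by rewrite !mul0r.
  transitivity (f i / p * m * ((q i)^-1 * q i)); first by rewrite invfM; ring.
  by rewrite mulVf // mulr1.
rewrite -mulr_suml -mulr_suml fp; have [p0|p0] := eqVneq p 0; last by rewrite divff // mul1r.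
have -> : m = 0 by lra.
by rewrite mulr0.
Qed.

Section DbarBound.
Variables (R : realType) (A : finPointedType) (mu nu : probability (biseq A) R).

Lemma coord_sum (la : probability (biseq A) R) :
  \sum_a fine (la (coord 0 a)) = 1.
Proof.
apply: EFin_inj; rewrite -sumEFin -(probability_setT la).
rewrite (measure_coord_split la 0 measurableT); apply: eq_bigr => a _.
by rewrite setTI fineK // fin_num_measure //; apply: measurable_coord.
Qed.

(** Reweighting the product measure by [f a b / (p a * q b)], with [f] a maximal coupling of the
    laws of coordinate 0, gives these coordinates the joint law [f] and preserves both marginals. *)
Lemma dbar_le_half_l1 : (dbar mu nu <=
  (2^-1 * \sum_a `|fine (mu (coord 0 a)) - fine (nu (coord 0 a))|)%:E)%E.
Proof.
set p := fun a => fine (mu (coord 0 a)); set q := fun a => fine (nu (coord 0 a)).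
have p0 a : 0 <= p a by apply: fine_ge0.
have q0 a : 0 <= q a by apply: fine_ge0.
have [f [f0 fp fq fd]] := max_coupling p0 q0 (coord_sum mu) (coord_sum nu).
have fle_q a b : 0 <= f a b <= q b.
  by rewrite f0 -fq (bigD1 a) //= lerDl sumr_ge0.
have fle_p b a : 0 <= f a b <= p a.
  by rewrite f0 -fp (bigD1 b) //= lerDl sumr_ge0.
have c0 (ab : A * A) : 0 <= f ab.1 ab.2 / (p ab.1 * q ab.2).
  by rewrite divr_ge0 // mulr_ge0.
pose c ab := NngNum (c0 ab).
have rE B : reweighted mu nu c B = (\sum_a \sum_b (f a b / (p a * q b))%:E *
    (mu \x nu) (B `&` rect (a, b)))%E by rewrite reweightedE.
have mE (la : probability (biseq A) R) B : measurable B ->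
    la B = (fine (la B))%:E by move=> mB; rewrite fineK // fin_num_measure.
have mI (B : set (biseq A)) a : measurable B -> measurable (B `&` coord 0 a).
  by move=> mB; apply: measurableI => //; apply: measurable_coord.
have fine_le (la : probability (biseq A) R) B a : measurable B ->
    0 <= fine (la (B `&` coord 0 a)) <= fine (la (coord 0 a)).
  move=> mB; rewrite fine_ge0 //= fine_le ?fin_num_measure //; try exact: mI;
    try exact: measurable_coord.
  by rewrite le_measure ?inE //; [exact: mI | exact: measurable_coord].
have marg1 B : measurable B -> reweighted mu nu c (fst @^-1` B) = mu B.
  move=> mB; rewrite rE (measure_coord_split mu 0 mB); apply: eq_bigr => a _.
  rewrite [RHS]mE; last exact: mI.
  rewrite -[in RHS](rescaled_sum (fle_q a) (fp a) (fine_le mu B a mB)) -sumEFin.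
  apply: eq_bigr => b _; rewrite [RHS]EFinM; congr (_ * _)%E.
  have -> : fst @^-1` B `&` rect (a, b) = (B `&` coord 0 a) `*` coord 0 b.
    by apply/seteqP; split => -[w w'] /=; [case=> ? [] | case=> -[]].
  rewrite product_measure1E; [|exact: mI|exact: measurable_coord].
  by rewrite EFinM -!mE //; [exact: measurable_coord | exact: mI].
have marg2 B : measurable B -> reweighted mu nu c (snd @^-1` B) = nu B.
  move=> mB; rewrite rE exchange_big /= (measure_coord_split nu 0 mB).
  apply: eq_bigr => b _; rewrite [RHS]mE; last exact: mI.
  rewrite -[in RHS](rescaled_sum (fle_p b) (fq b) (fine_le nu B b mB)) -sumEFin.
  apply: eq_bigr => a _; rewrite [RHS]EFinM [q b * p a]mulrC; congr (_ * _)%E.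
  have -> : snd @^-1` B `&` rect (a, b) = coord 0 a `*` (B `&` coord 0 b).
    by apply/seteqP; split => -[w w'] /=; [case=> ? [] | case=> ? []].
  rewrite product_measure1E; [|exact: measurable_coord|exact: mI].
  by rewrite mulrC EFinM -!mE //; [exact: mI | exact: measurable_coord].
have PT : reweighted mu nu c setT = 1%E.
  by rewrite -(preimage_setT fst) marg1 ?probability_setT.
pose P : probability (biseq A * biseq A)%type R :=
  HB.pack (reweighted mu nu c)
    (Measure_isProbability.Build _ _ _ (reweighted mu nu c) PT).
apply: ge_ereal_inf; exists (P [set w | w.1 0 != w.2 0]); first by exists P.
have -> : 2^-1 * \sum_a `|p a - q a| = \sum_a (p a - f a a).
  by rewrite sumrB fd (coord_sum mu) opprB addrC subrK.
rewrite [leLHS]rE -sumEFin le_eqVlt; apply/orP; left; apply/eqP; apply: eq_bigr => a _.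
rewrite -[in RHS]fp (bigD1 a) //= [in RHS](bigD1 a) //= addrAC subrr add0r -sumEFin.
rewrite [X in (X + _)%E](_ : _ = 0%E) ?add0e; last first.
  rewrite (_ : _ `&` _ = set0) ?measure0 ?mule0 //.
  by apply/seteqP; split => -[w w'] //= [/eqP h [wa wb]]; apply: h;
    exact: etrans wa (esym wb).
apply: eq_bigr => b ba.
rewrite (_ : _ `&` _ = rect (a, b)); last first.
  apply/seteqP; split => -[w w'] /=; first by case.
  by move=> h; split=> //; case: h => /= -> ->; rewrite eq_sym.
have -> : (mu \x nu)%E (rect (a, b)) = (p a * q b)%:E.
  rewrite product_measure1E; [|exact: measurable_coord|exact: measurable_coord].
  by rewrite EFinM -!mE //; exact: measurable_coord.
rewrite -EFinM; congr EFin.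
(* A null product forces [f a b = 0], which is bounded by both [p a] and [q b]. *)
have [pq0|pq0] := eqVneq (p a * q b) 0; last by rewrite divfK.
rewrite pq0 mulr0; move/eqP: pq0; rewrite mulf_eq0 => /orP[] /eqP h.
  by have := fle_p b a; rewrite h => ?; lra.
by have := fle_q a b; rewrite h => ?; lra.
Qed.

End DbarBound.

(** * The factor involving inf g, and the final estimate *)

Lemma sqrt_inf_kernel_or_var0 (R : realType) (A : finPointedType)
    (g : A -> past A -> R) k : is_kernel g ->
  Num.sqrt 2 * Num.sqrt (inf_kernel g) <= 1 \/ var g k = 0.
Proof.
move=> gK; have [g01 g1] := gK.
have [[b bp]|/forallNP all_pt] := pselect (exists b : A, b != point).
  (* Two distinct letters have probabilities at least inf g, adding up to at most 1. *)
  left; rewrite -sqrtrM // -[leRHS]sqrtr1 ler_wsqrtr //.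
  have := g1 point; rewrite (bigD1 point) //= (bigD1 b) //=.
  set s := \sum_(i | _) _ => h.
  have s0 : 0 <= s by apply: sumr_ge0 => i _; have /andP[] := g01 i point.
  have := inf_kernel_le gK point point; have := inf_kernel_le gK b point.
  lra.
have {}all_pt (a : A) : a = point by apply/eqP; apply: contraT => h; case: (all_pt a).
have gE a x : g a x = 1.
  by rewrite -(g1 x) (bigD1 a) //= big1 ?addr0 // => b; rewrite (all_pt b) (all_pt a) eqxx.
right; apply/eqP; rewrite eq_le var_ge0 // andbT.
apply: ge_sup => [|_ [a [z [z' [_ ->]]]]]; last by rewrite !gE subrr normr0.
by exists `|g point point - g point point|, point, point, point.
Qed.

Lemma mean_coord0 (R : realType) (A : finPointedType)
    (mu : probability (biseq A) R) (phi : A -> R) k :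
  shift_invariant mu -> (0 < k)%N ->
  mean point (weight mu) k (fun x => phi (x 0%N)) =
    \sum_a phi a * fine (mu (coord 0 a)).
Proof.
move=> inv; case: k => // k _; elim: k => [|k IH].
  rewrite /mean big_wordsS; apply: eq_bigr => a _; rewrite big_seq1 /= mulrC.
  congr (_ * _); apply: EFin_inj; rewrite weight_cons // cyl0 setIT fineK //.
  by rewrite fin_num_measure //; apply: measurable_coord.
by rewrite -IH -mean_localS // => [|x x' h]; [exact: weightP | rewrite h].
Qed.

Theorem corollary4p1 (R : realType) (A : finPointedType)
    (g : A -> past A -> R) (g_kernel : is_kernel g)
    (g_pos : 0 < inf_kernel g)
    (C : R)
    (hC : ((0 < Delta g)%E /\ C%:E = Delta g) \/ (0 < Gamma g /\ C = Gamma g))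
    (mu : probability (biseq A) R)
    (mu_inv : shift_invariant mu) (mu_g : compatible mu g)
    (y : past A) (k : nat) (hk : (1 <= k)%N)
    (muk : probability (biseq A) R)
    (muk_inv : shift_invariant muk)
    (muk_gk : compatible muk (markov_kernel g y k)) :
  (dbar mu muk <=
    (#|A|%:R / (2 * Num.sqrt 2 * C * Num.sqrt (inf_kernel g)) * var g k)%:E)%E.
Proof.
have C0 : 0 < C by case: hC => -[C0 CE]; [rewrite -lte_fin CE | rewrite CE].
(* Bounds the total variation distance between g and g^[k]: half of |A| terms, each at most
   var_k(g). *)
pose e := 2^-1 * (#|A|%:R * var g k).
have v0 : 0 <= var g k by apply: var_ge0.
have e0 : 0 <= e by rewrite !mulr_ge0.
apply: (@le_trans _ _ (e * C^-1)%:E); last first.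
  rewrite lee_fin; have [s1|vE] := sqrt_inf_kernel_or_var0 k g_kernel; last first.
    by rewrite /e vE !mulr0 mul0r.
  set s := Num.sqrt 2 * _ in s1.
  have s0 : 0 < s by rewrite mulr_gt0 ?sqrtr_gt0.
  have -> : #|A|%:R / (2 * Num.sqrt 2 * C * Num.sqrt (inf_kernel g)) * var g k
      = e * C^-1 * s^-1.
    rewrite (_ : 2 * Num.sqrt 2 * C * Num.sqrt (inf_kernel g) = 2 * C * s); last first.
      by rewrite /s; ring.
    by rewrite /e !invfM; ring.
  by rewrite ler_peMr ?invf_ge1 // mulr_ge0 // invr_ge0 ltW.
apply: le_trans (dbar_le_half_l1 _ _) _; rewrite lee_fin.
pose p a := fine (mu (coord 0 a)); pose q a := fine (muk (coord 0 a)).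
rewrite (half_l1_pos_part (coord_sum mu) (coord_sum muk)).
pose phi a : R := (q a <= p a)%R%:R.
have hphi a b : `|phi a - phi b| <= 1.
  by rewrite /phi; case: (q a <= p a); case: (q b <= p b);
    rewrite /= ?subrr ?subr0 ?sub0r ?normrN ?normr1 ?normr0.
have [u [r [M [hu hr hc hM]]]] := markov_iter_bounds g_kernel y hk hC hphi.
rewrite -(mean_coord0 phi mu_inv hk) -(mean_coord0 phi muk_inv hk).
apply: le_trans (ler_norm _) _.
have mK := markov_kernelP g_kernel y k.
have lK := markov_kernel_local g y (k := k).
apply: (mean_compare (weightP mu) (weightP muk) lK _ e0 _ _ hu hr hc hM).
- by move=> x x' h; rewrite h.
- apply: (weight_transition mu_inv mu_g) => // x; rewrite ler_wpM2l ?invr_ge0 //.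
  rewrite mulr_natl -sumr_const; apply: ler_sum => a _.
  by apply: ler_var => // i ik; rewrite /splice ik.
(* [muk] follows the Markov kernel exactly, hence the error 0. *)
- apply: (weight_transition muk_inv muk_gk) => // x.
  by rewrite big1 ?mulr0 // => a _; rewrite subrr normr0.
Qed.
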